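(* Let $\hbar>0$, $n\geq1$, and let $\Sigma$ be a real symmetric $2n\times 2n$ matrix such that the Hermitian matrix $\Sigma+\frac{i\hbar}{2}J$ is positive semidefinite, where $J=\begin{pmatrix}0_{n\times n}&I_{n\times n}\\-I_{n\times n}&0_{n\times n}\end{pmatrix}$ (so $\Sigma$ is positive definite). Let $\Omega_\Sigma=\{z\in\mathbb{R}^{2n}:\tfrac12 z^T\Sigma^{-1}z\leq1\}$, and let $X\subset\mathbb{R}^n_x$ and $P\subset\mathbb{R}^n_p$ be the orthogonal projections of $\Omega_\Sigma$ onto the position space $\mathbb{R}^n_x$ and momentum space $\mathbb{R}^n_p$ respectively, where $\mathbb{R}^{2n}=\mathbb{R}^n_x\times\mathbb{R}^n_p$. Then $(X,P)$ is a $\hbar$-polar quantum pair, i.e. $X^{\hbar}\subset P$, and hence $c_{\mathrm{HZ}}(X\times P)\geq 4\hbar$.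
   Context: For a centrally symmetric convex body $X\subset\mathbb{R}^n_x$ (compact convex with nonempty interior, $X=-X$), its $\hbar$-polar set is $X^{\hbar}=\{p\in\mathbb{R}^n_p: p^Tx\leq\hbar\text{ for all }x\in X\}$; a pair $(X,P)$ of such bodies is a $\hbar$-polar quantum pair if $X^{\hbar}\subset P$. Phase space $\mathbb{R}^{2n}$ carries the standard symplectic form $\sigma(z,z')=(z')^TJz$. $c_{\mathrm{HZ}}$ denotes the Hofer–Zehnder symplectic capacity; for a compact convex set with nonempty interior it equals the minimal (positive) action $\oint p\,dx$ among closed characteristics (periodic Hamiltonian orbits) on its boundary. *)

(* Defs.v *)
From mathcomp Require Import all_boot all_order all_algebra.
From mathcomp.real_closed Require Import complex.
From mathcomp Require Import all_classical all_reals all_analysis.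
Set Implicit Arguments.
Unset Strict Implicit.
Unset Printing Implicit Defensive.
Import Order.TTheory GRing.Theory Num.Theory.
Import numFieldTopology.Exports numFieldNormedType.Exports.
Local Open Scope classical_set_scope.
Local Open Scope ring_scope.

Section Defs.
Variable R : realType.

(* Phase space R^{2n} = R^n_x x R^n_p, vectors are columns 'cV_(n + n);
   x-part = usubmx z, p-part = dsubmx z. *)

Definition Jmx (n : nat) : 'M[R]_(n + n) := block_mx 0 1%:M (- 1%:M) 0.

Definition cplx_mx (m k : nat) (M : 'M[R]_(m, k)) : 'M[R[i]]_(m, k) :=
  map_mx (fun r : R => (r%:C)%C) M.

Definition adjmx (m k : nat) (M : 'M[R[i]]_(m, k)) : 'M[R[i]]_(k, m) :=
  (map_mx Num.conj M)^T.

Definition herm_psd (m : nat) (M : 'M[R[i]]_m) : Prop :=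
  adjmx M = M /\ forall w : 'cV[R[i]]_m, 0 <= (adjmx w *m M *m w) 0 0.

Definition Omega (n : nat) (Sigma : 'M[R]_(n + n)) : set 'cV[R]_(n + n) :=
  [set z | 2^-1 * (z^T *m invmx Sigma *m z) 0 0 <= 1].

Definition projX (n : nat) (S : set 'cV[R]_(n + n)) : set 'cV[R]_n :=
  [set x | exists p : 'cV[R]_n, S (col_mx x p)].
Definition projP (n : nat) (S : set 'cV[R]_(n + n)) : set 'cV[R]_n :=
  [set p | exists x : 'cV[R]_n, S (col_mx x p)].

Definition dotv (m : nat) (u v : 'cV[R]_m) : R := (u^T *m v) 0 0.

Definition convex_set (m : nat) (K : set 'cV[R]_m) : Prop :=
  forall x y, K x -> K y -> forall t : R, 0 <= t <= 1 ->
    K (t *: x + (1 - t) *: y).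

Definition convex_body (m : nat) (K : set 'cV[R]_m) : Prop :=
  compact K /\ convex_set K /\ interior K !=set0.

Definition sym_convex_body (m : nat) (K : set 'cV[R]_m) : Prop :=
  convex_body K /\ forall x, K x -> K (- x).

Definition hpolar (n : nat) (hbar : R) (X : set 'cV[R]_n) : set 'cV[R]_n :=
  [set p | forall x, X x -> dotv p x <= hbar].

Definition quantum_pair (n : nat) (hbar : R) (X P : set 'cV[R]_n) : Prop :=
  sym_convex_body X /\ sym_convex_body P /\ hpolar hbar X `<=` P.

Definition phase_prod (n : nat) (X P : set 'cV[R]_n) : set 'cV[R]_(n + n) :=
  [set z | X (usubmx z) /\ P (dsubmx z)].

Definition normal_cone (m : nat) (K : set 'cV[R]_m) (z : 'cV[R]_m)
  : set 'cV[R]_m :=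
  [set u | forall w, K w -> dotv u (w - z) <= 0].

(* Generalized closed characteristic of period T on the boundary of a convex
   body K: a nonconstant, Lipschitz, T-periodic loop on the boundary of K
   with  dz/dt in J N_K(z(t))  for almost every t  (i.e. a periodic orbit of
   the (generalized) Hamiltonian dynamics on the boundary of K). *)
Definition closed_characteristic (n : nat) (K : set 'cV[R]_(n + n))
  (g : R -> 'cV[R]_(n + n)) (T : R) : Prop :=
  0 < T /\
  (forall t, g (t + T) = g t) /\
  (forall t, (K `\` interior K) (g t)) /\
  (exists L : R, forall s t, `|g s - g t| <= L * `|s - t|) /\
  (exists s t, g s != g t) /\
  (exists N : set R, (@lebesgue_measure R).-negligible N /\
         forall t, ~ N t ->
           derivable g t 1 /\
           exists2 u, normal_cone K (g t) u & 'D_1 g t = Jmx n *m u).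

Definition action (n : nat) (g : R -> 'cV[R]_(n + n)) (T : R) : R :=
  fine (\int[@lebesgue_measure R]_(t in `[0%R, T])
          (dotv (dsubmx (g t)) (usubmx ('D_1 g t)))%:E)%E.

(* Hofer-Zehnder capacity of a convex body: minimal positive action among
   closed characteristics on its boundary. *)
Definition cHZ (n : nat) (K : set 'cV[R]_(n + n)) : R :=
  inf [set a | exists g T, closed_characteristic K g T /\
                           a = action g T /\ 0 < a].

End Defs.

(* Main.v *)
(* A closed characteristic [(x, p)] on the boundary of [X * P] satisfies
   [p . x' = max_P q . x'] and [- p' . x = max_X (- p' . y)] almost everywhere.
   Let [A] be its action. As [P] contains the polar [X^hbar], the [x]-loop has
   length at most [A / hbar] for the gauge of [X]; cutting it into two halves of
   equal length shows that it stays at gauge distance at most [A / (4 hbar)] from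
   a point [m]. Hence [- p' . (x - m) <= A / (4 hbar) * (- p' . x)]; integrating
   over a period, where [- p' . x] integrates to [A] and [p'] to [0], gives
   [A <= A^2 / (4 hbar)], that is [A >= 4 hbar]. The infimum defining the
   capacity is not over the empty set: a pair [(x, p)] maximizing [p . x] on
   [X * P] yields a bouncing orbit of positive action.

   The inclusion [X^hbar <= P] is the uncertainty inequality
   [a^T Sigma a + b^T Sigma b >= hbar a^T J b] (the positivity of
   [Sigma + i hbar / 2 J] on [a + i b]) evaluated at suitable [a] and [b]. *)
Require Import Defs.
From mathcomp Require Import all_boot all_order all_algebra.
From mathcomp.real_closed Require Import complex.
From mathcomp Require Import all_classical all_reals all_analysis.
From mathcomp Require Import measurable_realfun ring lra.
Set Implicit Arguments.
Unset Strict Implicit.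
Unset Printing Implicit Defensive.
Import Order.TTheory GRing.Theory Num.Theory.
Import numFieldTopology.Exports numFieldNormedType.Exports.
Local Open Scope classical_set_scope.
Local Open Scope ring_scope.

(** * Lipschitz functions with an almost everywhere derivative *)

Section integral_off_null.
Import HBNNSimple.

(* Measurability is not assumed: lebesgue_measure is defined on Borel sets only,
   and the junk values of 'D_1 g on the exceptional null set of a characteristic
   need not be Borel measurable. *)
Lemma integral_off_null d (T : measurableType d) (R : realType)
    (mu : {measure set T -> \bar R}) (D B : set T) (f h : T -> \bar R) :
  measurable B -> mu B = 0%E -> (forall x, ~ B x -> f x = h x) ->
  (\int[mu]_(x in D) f x = \int[mu]_(x in D) h x)%E.
Proof.
move=> mB B0.
have le_nn (f1 h1 : T -> \bar R) : (forall x, 0 <= f1 x)%E ->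
    (forall x, 0 <= h1 x)%E -> (forall x, ~ B x -> f1 x = h1 x) ->
    (\int[mu]_x f1 x <= \int[mu]_x h1 x)%E.
  move=> f0 h0 fh; rewrite (ge0_integralTE mu f0) (ge0_integralTE mu h0).
  apply: ge_ereal_sup => _ [s /= sf <-].
  apply: ereal_sup_ubound => /=.
  (* Cutting a simple function below [f1] to zero on [B] puts it below [h1] and keeps its integral,
     since [B] is null. *)
  exists (mul_nnsfun s (indic_nnsfun R (measurableC mB))) => [x|].
    rewrite /= mindicE; case: (pselect (B x)) => Bx.
      by rewrite memNset//= ?mulr0 ?h0//; apply.
    by rewrite mem_set//= mulr1 -fh.
  rewrite -!integralT_nnsfun; apply: ae_eq_integral => //.
  - exact/measurable_EFinP.
  - exact/measurable_EFinP.
  - exists B; split => // x /=; apply: contra_notP => Bx _.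
    by rewrite /= mindicE mem_set// mulr1.
have eq_nn (f1 h1 : T -> \bar R) : (forall x, 0 <= f1 x)%E ->
    (forall x, 0 <= h1 x)%E -> (forall x, ~ B x -> f1 x = h1 x) ->
    (\int[mu]_x f1 x = \int[mu]_x h1 x)%E.
  by move=> f0 h0 fh; apply/eqP; rewrite eq_le !le_nn// => x /fh.
move=> fh; rewrite integral_mkcond [RHS]integral_mkcond.
rewrite integralE [RHS]integralE; congr (_ - _)%E; apply: eq_nn => // x Bx;
  by rewrite ?funeposE ?funenegE /patch fh.
Qed.

End integral_off_null.

Section lipschitz_FTC.
Context {R : realType}.
Notation mu := (@lebesgue_measure R).
Implicit Types (f df : R -> R) (B : set R) (C : R).

Lemma lipschitz_continuous f C :
  (forall s t, `|f s - f t| <= C * `|s - t|) -> continuous f.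
Proof.
move=> fC t; apply/cvgrPdist_lt => e e0.
have C0 : 0 < `|C| + 1 by rewrite ltr_wpDl.
near=> s.
apply: (le_lt_trans (fC t s)).
apply: (@le_lt_trans _ _ ((`|C| + 1) * `|t - s|)).
  by rewrite ler_wpM2r// (le_trans (ler_norm C))// lerDl.
rewrite -ltr_pdivlMl//.
near: s; apply/nbhs_ballP; exists ((`|C| + 1)^-1 * e) => //=.
by rewrite mulr_gt0 ?invr_gt0.
Unshelve. all: by end_near. Qed.

Lemma continuous_antiderivative f (a b : R) : continuous f ->
  exists F : R -> R, forall x, a < x < b -> is_derive x 1 F (f x).
Proof.
move=> cf; exists (fun x => \int[mu]_(t in `[a, x]) f t)%R => x /andP[ax xb].
have fi : mu.-integrable `[a, b] (EFin \o f).
  apply: continuous_compact_integrable; first exact: segment_compact.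
  by apply: continuous_subspaceT => ?; exact: cf.
have [dF F'] := @continuous_FTC1_closed R f a x b xb fi ax (cf x).
by apply: DeriveDef => //; rewrite -derive1E.
Qed.

(* The difference quotients of [f] are bounded by [C], so dominated convergence
   reduces the claim to the derivative of an antiderivative of [f]. *)
Lemma lipschitz_derivative_integral f df C B (a b : R) : a <= b ->
  (forall s t, `|f s - f t| <= C * `|s - t|) ->
  measurable B -> mu B = 0%E ->
  (forall t, ~ B t -> is_derive t 1 f (df t)) -> (forall t, B t -> df t = 0) ->
  [/\ measurable_fun setT df, forall t, `|df t| <= C &
      \int[mu]_(t in `[a, b]) df t = f b - f a].
Proof.
move=> ab fC mB B0 fdf df0.
have cf := @lipschitz_continuous f C fC.
pose h n : R := n.+1%:R^-1.
have h0 n : 0 < h n by rewrite invr_gt0.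
have hcvg : h n @[n --> \oo] --> 0 by exact: cvg_harmonic.
have quot_cvg (g : R -> R) (dg t : R) : is_derive t 1 g dg ->
    (h n)^-1 * (g (t + h n) - g t) @[n --> \oo] --> dg.
  move=> [dgt <-].
  have h_dnbhs : h n @[n --> \oo] --> 0^'.
    move=> A; rewrite /= /dnbhs /within/= => /hcvg; rewrite !near_simpl => AA.
    near=> n; have : h n != 0 -> A (h n) by near: n.
    by apply; rewrite gt_eqF.
  have := cvg_comp _ _ h_dnbhs dgt.
  apply: cvg_trans; apply: near_eq_cvg; apply: nearW => n /=.
  rewrite [t + _]addrC; have -> : (h n)%:A = h n; first exact: mulr1.
  exact: erefl.
pose q n t : R := (h n)^-1 * (f (t + h n) - f t).
(* Zeroing the quotients on [B] matches the value of [df] there, so they converge at every point and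
   [df] is measurable as a pointwise limit. *)
pose qB n : R -> R := q n \* \1_(~` B).
have cq n : continuous (q n).
  move=> t; apply: cvgM; first exact: cvg_cst.
  apply: cvgB; last exact: cf.
  apply: (@continuous_comp _ _ _ (fun t => t + h n) f); last exact: cf.
  by apply: cvgD; [exact: cvg_id|exact: cvg_cst].
have C0 : 0 <= C by have := fC 1 0; rewrite subr0 normr1 mulr1; exact: le_trans.
have q_le n t : `|q n t| <= C.
  rewrite normrM ger0_norm ?invr_ge0 ?(ltW (h0 n))// ler_pdivrMl// mulrC.
  by apply: (le_trans (fC _ _)); rewrite addrAC subrr add0r gtr0_norm.
have qB_le n t : `|qB n t| <= C.
  rewrite /qB/= indicE normrM; case: (_ \in _) => /=.
    by rewrite normr1 mulr1.
  by rewrite normr0 mulr0.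
have mqB n : measurable_fun setT (qB n).
  apply: measurable_funM; first exact: continuous_measurable_fun.
  exact/measurable_indic/measurableC.
have qB_cvg t : qB n t @[n --> \oo] --> df t.
  rewrite /qB/= indicE; case: (pselect (B t)) => Bt.
    rewrite (_ : (t \in ~` B) = false) ?df0//=; last by apply: memNset; apply.
    by under eq_cvg do rewrite mulr0; exact: cvg_cst.
  rewrite mem_set//=; under eq_cvg do rewrite mulr1.
  exact/quot_cvg/fdf.
have mdf : measurable_fun setT df.
  apply: (measurable_fun_cvg mqB) => t _; exact: qB_cvg.
have df_le t : `|df t| <= C.
  have dn : `|qB n t| @[n --> \oo] --> `|df t| by apply: cvg_norm; exact: qB_cvg.
  rewrite -(cvg_lim _ dn)//; apply: limr_le; first by apply/cvg_ex; exists `|df t|.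
  by apply: nearW => n; exact: qB_le.
split => //.
have [->|aneqb] := eqVneq a b.
  by rewrite subrr set_itv1 Rintegral_set1.
have {aneqb ab} ab : a < b by rewrite lt_neqAle aneqb ab.
(* As [h n <= 1], these margins keep [t] and [t + h n] strictly inside the interval for every [t] in
   [[a, b]], endpoints included. *)
have [F Ff] := @continuous_antiderivative f (a - 1) (b + 2) cf.
have h1 n : h n <= 1 by rewrite invf_le1// ler1n.
(* On [[a, b]], [G n] is an antiderivative of [q n]; its endpoint values are difference quotients of
   [F], tending to [f b] and [f a]. *)
pose G n (t : R) : R := (h n)^-1 * (F (t + h n) - F t).
have dG n (t : R) : a <= t <= b -> is_derive t 1 (G n) (q n t).
  move=> /andP[at_ tb]; have [h_gt0 h_le1] := (h0 n, h1 n).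
  have Ft : is_derive t 1 F (f t) by apply: Ff; lra.
  have Fth : is_derive (t + h n) 1 F (f (t + h n)) by apply: Ff; lra.
  have Fsh : is_derive t 1 (F \o shift (h n)) (f (t + h n)).
    rewrite -[f _]mulr1.
    exact: (@is_derive1_comp R F (shift (h n)) t _ _ Fth (is_derive_shift t 1 (h n))).
  exact: (is_deriveZ ((h n)^-1) (is_deriveB Fsh Ft)).
have intG n : (\int[mu]_(t in `[a, b]) (qB n t)%:E = (G n b - G n a)%:E)%E.
  have -> : (\int[mu]_(x in `[a, b]) (qB n x)%:E = \int[mu]_(x in `[a, b]) (q n x)%:E)%E.
    apply: (@integral_off_null _ _ R mu _ B) => // t Bt.
    by rewrite /qB/= indicE mem_set// mulr1.
  rewrite (@continuous_FTC2 _ _ (G n))// ?EFinB//.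
  - by apply: continuous_subspaceT => ?; exact: cq.
  - have cG t : a <= t <= b -> G n @ t --> G n t.
      move=> /(dG n)[dGt _].
      by apply/differentiable_continuous/derivable1_diffP.
    split.
    + by move=> t; rewrite in_itv/= => /andP[at_ tb]; case: (dG n t) => //; lra.
    + by apply: cvg_at_right_filter; apply: cG; lra.
    + by apply: cvg_at_left_filter; apply: cG; lra.
  - move=> t; rewrite in_itv/= => /andP[at_ tb]; rewrite derive1E.
    by case: (dG n t) => //; lra.
have cvgG : (G n b - G n a)%:E @[n --> \oo] --> (f b - f a)%:E.
  apply: cvg_EFin; first exact: nearW.
  by apply: cvgB; apply: quot_cvg; apply: Ff; lra.
have [] := @dominated_convergence _ _ _ mu `[a, b]%classic (measurable_itv _)
  (fun n t => (qB n t)%:E) (fun t => (df t)%:E) (cst C%:E).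
- move=> n; apply/measurable_EFinP; exact: measurable_funS (mqB n).
- by apply/measurable_EFinP; exact: measurable_funS mdf.
- apply: aeW => t _; apply: cvg_EFin; [exact: nearW|exact: qB_cvg].
- apply: measurable_bounded_integrable => //; last exact: bounded_cst.
  have : (mu `[a, b]%classic < +oo)%E by rewrite lebesgue_measure_itv/= lte_fin ab -EFinB ltry.
  exact.
- by apply: aeW => t n _; rewrite lee_fin; exact: qB_le.
move=> _ _ dc.
have dfE : (\int[mu]_(x in `[a, b]) (df x)%:E = (f b - f a)%:E)%E.
  apply: cvg_unique cvgG => //; move: dc; apply: cvg_trans; apply: near_eq_cvg.
  by apply: nearW => n; exact: intG.
by rewrite /Rintegral dfE.
Unshelve. all: by end_near. Qed.
End lipschitz_FTC.

Section lipschitz_comparison.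
Context {R : realType}.
Notation mu := (@lebesgue_measure R).

Lemma bounded_integrable_itv (l : R -> R) (C a b : R) (ba bb : bool) :
  measurable_fun setT l -> (forall t, `|l t| <= C) ->
  mu.-integrable [set` Interval (BSide ba a) (BSide bb b)] (EFin \o l).
Proof.
move=> ml lC; apply: measurable_bounded_integrable => //.
- have : (mu [set` Interval (BSide ba a) (BSide bb b)] < +oo)%E.
    by rewrite lebesgue_measure_itv/=; case: ifPn => // _; rewrite -EFinB ltry.
  exact.
- exact: measurable_funS ml.
- exists C; split; first exact: num_real.
  by move=> M CM t _ /=; rewrite (le_trans (lC t))// ltW.
Qed.

(** The factor [c] may have any sign: it is 1 in the displacement estimate and a multiplier of
    unknown sign in the final bound on the action. *)
Lemma lipschitz_le_integral (f df l : R -> R) (C D c : R) (B : set R) (a b : R) :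
  a <= b ->
  (forall s t, `|f s - f t| <= C * `|s - t|) ->
  measurable B -> mu B = 0%E ->
  (forall t, ~ B t -> is_derive t 1 f (df t)) ->
  measurable_fun setT l -> (forall t, `|l t| <= D) ->
  (forall t, B t -> l t = 0) ->
  (forall t, ~ B t -> a <= t <= b -> df t <= c * l t) ->
  f b - f a <= c * \int[mu]_(t in `[a, b]) l t.
Proof.
move=> ab fC mB B0 fdf ml lD l0 dfl.
pose df0 t := if t \in B then 0 else df t.
have [||mdf dfC <-] := @lipschitz_derivative_integral R f df0 C B a b ab fC mB B0.
- by move=> t Bt; rewrite /df0 memNset//; exact: fdf.
- by move=> t Bt; rewrite /df0 mem_set.
rewrite -RintegralZl//; last exact: (@bounded_integrable_itv _ D).
apply: le_Rintegral => //.
- exact: (@bounded_integrable_itv _ C).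
- apply: (@bounded_integrable_itv _ (`|c| * D)); first exact: measurable_funM.
  by move=> t; rewrite normrM ler_wpM2l.
- move=> t /=; rewrite in_itv/= /df0 => tab; case: (pselect (B t)) => Bt.
    by rewrite mem_set// l0// mulr0.
  by rewrite memNset//; exact: dfl.
Qed.

End lipschitz_comparison.

(** * Dot product and maximum norm of column vectors *)

Section dot_product.
Context {R : realType} {n : nat}.
Implicit Types u v w : 'cV[R]_n.

Lemma dotvE u v : dotv u v = \sum_i u i 0 * v i 0.
Proof. by rewrite /dotv mxE; apply: eq_bigr => i _; rewrite mxE. Qed.

Lemma dotvC u v : dotv u v = dotv v u.
Proof. by rewrite !dotvE; apply: eq_bigr => i _; rewrite mulrC. Qed.

Lemma dotvDl u v w : dotv (u + v) w = dotv u w + dotv v w.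
Proof. by rewrite /dotv linearD mulmxDl mxE. Qed.

Lemma dotvNl u w : dotv (- u) w = - dotv u w.
Proof. by rewrite /dotv linearN mulNmx mxE. Qed.

Lemma dotvZl c u w : dotv (c *: u) w = c * dotv u w.
Proof. by rewrite /dotv linearZ -scalemxAl mxE. Qed.

Lemma dotvBl u v w : dotv (u - v) w = dotv u w - dotv v w.
Proof. by rewrite dotvDl dotvNl. Qed.

Lemma dotvDr w u v : dotv w (u + v) = dotv w u + dotv w v.
Proof. by rewrite dotvC dotvDl !(dotvC w). Qed.

Lemma dotvNr w u : dotv w (- u) = - dotv w u.
Proof. by rewrite dotvC dotvNl (dotvC w). Qed.

Lemma dotvBr w u v : dotv w (u - v) = dotv w u - dotv w v.
Proof. by rewrite dotvDr dotvNr. Qed.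

Lemma dotvZr c w u : dotv w (c *: u) = c * dotv w u.
Proof. by rewrite dotvC dotvZl (dotvC w). Qed.

Lemma dot0v w : dotv 0 w = 0.
Proof. by rewrite /dotv trmx0 mul0mx mxE. Qed.

Lemma normr_coord_le u i : `|u i 0| <= `|u|.
Proof.
by rewrite [leRHS]/Num.Def.normr/= mx_normrE; apply: (le_bigmax _ _ (i, 0)).
Qed.

(** The norm is the maximum of the absolute values of the coordinates, whence the factor [n]. *)
Lemma normr_dotv_le u v : `|dotv u v| <= n%:R * (`|u| * `|v|).
Proof.
rewrite dotvE (le_trans (ler_norm_sum _ _ _))//.
have -> : n%:R * (`|u| * `|v|) = \sum_(i < n) `|u| * `|v|.
  by rewrite sumr_const card_ord mulr_natl.
by apply: ler_sum => i _; rewrite normrM ler_pM ?normr_coord_le.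
Qed.

Lemma is_derive_dotv (a b : R -> 'cV[R]_n) (da db : 'cV[R]_n) (t : R) :
  (forall i, is_derive t 1 (fun t => a t i 0) (da i 0)) ->
  (forall i, is_derive t 1 (fun t => b t i 0) (db i 0)) ->
  is_derive t 1 (fun t => dotv (a t) (b t)) (dotv da (b t) + dotv (a t) db).
Proof.
move=> ha hb.
have -> : (fun t => dotv (a t) (b t)) =
    \sum_i ((fun t => a t i 0) * (fun t => b t i 0)).
  by apply/funext => s; rewrite dotvE fct_sumE.
rewrite !dotvE -big_split /=; apply: is_derive_sum => i.
have -> : da i 0 * b t i 0 + a t i 0 * db i 0 =
    a t i 0 *: db i 0 + b t i 0 *: da i 0.
  by rewrite addrC [da i 0 * _]mulrC.
exact: is_deriveM.
Qed.

End dot_product.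

(** * Lower bound on the action *)

Section action_bound.
Context {R : realType} {n : nat}.
Notation mu := (@lebesgue_measure R).
Variables (hbar T C M : R) (B : set R) (X P : set 'cV[R]_n).
Variables x p dx dp : R -> 'cV[R]_n.
Hypotheses (hbar0 : 0 < hbar) (T0 : 0 < T).
Hypothesis XN : forall y, X y -> X (- y).
Hypothesis polarXP : hpolar hbar X `<=` P.
Hypotheses (xX : forall t, X (x t)) (pP : forall t, P (p t)).
Hypotheses (xM : forall t, `|x t| <= M) (pM : forall t, `|p t| <= M).
Hypotheses (xC : forall s t, `|x s - x t| <= C * `|s - t|).
Hypotheses (pC : forall s t, `|p s - p t| <= C * `|s - t|).
Hypotheses (xT : x T = x 0) (pT : p T = p 0).
Hypotheses (mB : measurable B) (B0 : mu B = 0%E).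
Hypothesis dxE : forall t, ~ B t ->
  forall i, is_derive t 1 (fun t => x t i 0) (dx t i 0).
Hypothesis dpE : forall t, ~ B t ->
  forall i, is_derive t 1 (fun t => p t i 0) (dp t i 0).
Hypothesis dx_normal : forall t, ~ B t -> normal_cone P (p t) (dx t).
Hypothesis dp_normal : forall t, ~ B t -> normal_cone X (x t) (- dp t).

(** Vanishing on [B] makes the integrand of the action bounded and measurable, whatever the values
    of [dx] there. *)
Definition action_density (t : R) : R :=
  if t \in B then 0 else dotv (p t) (dx t).

Let l := action_density.
Let A := \int[mu]_(t in `[0, T]) l t.

Let M0 : 0 <= M. Proof. exact: le_trans (xM 0). Qed.
Let C0 : 0 <= C.
Proof. by have := xC 1 0; rewrite subr0 normr1 mulr1; exact: le_trans. Qed.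

Let dx0 (t : R) (i : 'I_n) : R := if t \in B then 0 else dx t i 0.

Let dx0_prop i : measurable_fun setT (dx0 ^~ i) /\ forall t, `|dx0 t i| <= C.
Proof.
(* The interval is a single point: only measurability and the bound are wanted here. *)
have [] := @lipschitz_derivative_integral R (fun t => x t i 0) (dx0 ^~ i) C B 0 0
  (lexx 0) _ mB B0.
- move=> s t; apply: le_trans (xC s t).
  by have := normr_coord_le (x s - x t) i; rewrite !mxE.
- by move=> t Bt; rewrite /dx0 memNset//; exact: dxE.
- by move=> t Bt; rewrite /dx0 mem_set.
- by [].
Qed.

Let lE t : l t = \sum_i p t i 0 * dx0 t i.
Proof.
rewrite /l /action_density /dx0; case: ifPn => _; last exact: dotvE.
by rewrite big1// => i _; rewrite mulr0.
Qed.

Let ml : measurable_fun setT l.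
Proof.
rewrite (_ : l = fun t => \sum_i p t i 0 * dx0 t i); last exact/funext/lE.
apply: measurable_sum => i; apply: measurable_funM; last by case: (dx0_prop i).
apply: continuous_measurable_fun; apply: (@lipschitz_continuous _ _ C) => s t.
apply: le_trans (pC s t).
by have := normr_coord_le (p s - p t) i; rewrite !mxE.
Qed.

Let D := n%:R * (M * C).

Let lD t : `|l t| <= D.
Proof.
rewrite lE (le_trans (ler_norm_sum _ _ _))//.
have -> : D = \sum_(i < n) M * C by rewrite sumr_const card_ord /D mulr_natl.
apply: ler_sum => i _; rewrite normrM ler_pM//; last by case: (dx0_prop i).
exact: le_trans (normr_coord_le _ _) (pM t).
Qed.

Let l0 t : B t -> l t = 0.
Proof. by move=> Bt; rewrite /l /action_density mem_set. Qed.

Let dotv_lipschitz (a b : R -> 'cV[R]_n) (Ca Cb Ma Mb : R) :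
  (forall s t, `|a s - a t| <= Ca * `|s - t|) ->
  (forall s t, `|b s - b t| <= Cb * `|s - t|) ->
  (forall t, `|a t| <= Ma) -> (forall t, `|b t| <= Mb) ->
  forall s t, `|dotv (a s) (b s) - dotv (a t) (b t)|
    <= n%:R * (Ca * Mb + Ma * Cb) * `|s - t|.
Proof.
move=> aC bC aM bM s t.
have -> : dotv (a s) (b s) - dotv (a t) (b t) =
    dotv (a s - a t) (b s) + dotv (a t) (b s - b t).
  by rewrite dotvBl dotvBr; ring.
rewrite (le_trans (ler_normD _ _))// -mulrA mulrDl mulrDr lerD//.
  rewrite (le_trans (normr_dotv_le _ _))// ler_wpM2l//.
  by rewrite mulrAC ler_pM.
rewrite (le_trans (normr_dotv_le _ _))// ler_wpM2l//.
by rewrite -mulrA ler_pM.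
Qed.

(** The action accumulated since time 0, which acts as an arc length along the [x]-loop. *)
Let L t := \int[mu]_(s in `[0, t]) l s.

Let int_l s t : 0 <= s -> s <= t -> \int[mu]_(r in `[s, t]) l r = L t - L s.
Proof.
move=> s0 st; rewrite /L Rintegral_itvB ?bnd_simp//; last first.
  exact: (@bounded_integrable_itv _ _ D).
rewrite Rintegral_itv_obnd_cbnd//.
exact: (@bounded_integrable_itv _ _ D).
Qed.

Let L0 : L 0 = 0.
Proof. by rewrite /L set_itv1 Rintegral_set1. Qed.

(** As [dx] is normal to [P] at [p], the product [q . dx] is at most [p . dx] off [B]; integrate
    over [[s, t]]. *)
Lemma dotv_displacement_le q s t : P q -> 0 <= s -> s <= t ->
  dotv q (x t - x s) <= L t - L s.
Proof.
move=> Pq s0 st; rewrite dotvBr -int_l// -[leRHS]mul1r.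
apply: (@lipschitz_le_integral _ (fun t => dotv q (x t)) (fun t => dotv q (dx t))
   l (n%:R * (0 * M + `|q| * C)) D 1 B s t st) => //.
- apply: (dotv_lipschitz (a := fun=> q)) => // ? ?.
  by rewrite subrr normr0 mul0r.
- move=> r Br; have := @is_derive_dotv _ _ (fun=> q) x 0 (dx r) r _ (dxE Br).
  rewrite dot0v add0r; apply => i; rewrite mxE; exact: is_derive_cst.
- move=> r Br _; rewrite mul1r /l /action_density memNset//.
  by have := dx_normal Br Pq; rewrite dotvBr subr_le0 !(dotvC (dx r)).
Qed.

(** The displacement bounds on [[0, s]] and on [[s, T]] add up to the whole action, because the loop
    closes. *)
Lemma action_ge_displacements q q' s : P q -> P q' -> 0 <= s -> s <= T ->
  dotv q (x s - x 0) + dotv q' (x 0 - x s) <= A.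
Proof.
move=> Pq Pq' s0 sT.
have h1 := @dotv_displacement_le q 0 s Pq (lexx _) s0.
have h2 := @dotv_displacement_le q' s T Pq' s0 sT.
rewrite xT in h2.
by apply: le_trans (lerD h1 h2) _; rewrite L0 -/(L T) /A -/(L T); lra.
Qed.

(* [m] is the midpoint of [x 0] and of the point reached at half of the action. *)
Lemma loop_near_center : 0 < A ->
  exists2 m, (exists y z, [/\ X y, X z & m = 2^-1 *: (y + z)]) &
  forall q t, P q -> P (- q) -> 0 <= t <= T -> dotv q (x t - m) <= A / 4.
Proof.
move=> A0.
have [|||tau] := @IVT _ L 0 T (A / 2).
- exact: ltW.
- apply: parameterized_integral_continuous; first exact: ltW.
  exact: (@bounded_integrable_itv _ _ D).
- rewrite L0 -/A; have -> : L T = A by [].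
  by rewrite min_l ?max_r ?(ltW A0)//; apply/andP; split; lra.
rewrite in_itv/= => /andP[tau0 tauT] Ltau.
exists (2^-1 *: (x 0 + x tau)); first by exists (x 0), (x tau).
move=> q t Pq PNq /andP[t0 tT].
suff : dotv q (x t - x 0) + dotv q (x t - x tau) <= A / 2.
  by rewrite !dotvBr dotvZr dotvDr; lra.
(* The half-loop containing [t] has action [A / 2] and is cut at [t]; [q] bounds the displacement
   along one piece and [- q] along the other. *)
have [ttau|/ltW taut] := leP t tau.
  have := dotv_displacement_le Pq (lexx 0) t0.
  have := dotv_displacement_le PNq t0 ttau.
  by rewrite !dotvBr !dotvNl L0 Ltau; lra.
have := dotv_displacement_le Pq tau0 taut.
have := dotv_displacement_le PNq t0 tT.
have -> : L T = A by [].
by rewrite xT !dotvBr !dotvNl Ltau; lra.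
Qed.

(** The maximum of [u := - dp t] on [X] is [u . x t]. If it is positive, rescaling [u] to have
    maximum [hbar] gives a point of the polar, hence of [P], as is its opposite. Otherwise [u]
    vanishes on [X] by symmetry and both sides are 0. *)
Lemma normal_center_le m t : ~ B t -> 0 <= t <= T ->
  (exists y z, [/\ X y, X z & m = 2^-1 *: (y + z)]) ->
  (forall q t, P q -> P (- q) -> 0 <= t <= T -> dotv q (x t - m) <= A / 4) ->
  hbar * dotv (- dp t) (x t - m) <= A / 4 * dotv (- dp t) (x t).
Proof.
move=> Bt tT [y [z [Xy Xz mE]]] mA.
pose u := - dp t; rewrite -/u.
have u_le w : X w -> dotv u w <= dotv u (x t).
  by move=> Xw; have := dp_normal Bt Xw; rewrite -/u dotvBr subr_le0.
have u_ge w : X w -> - dotv u w <= dotv u (x t).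
  by move=> /XN/u_le; rewrite dotvNr.
have [h0|hN0] := ltP 0 (dotv u (x t)).
  pose q := (hbar / dotv u (x t)) *: u.
  have hq : 0 < hbar / dotv u (x t) by rewrite divr_gt0.
  have q_polar w : X w -> dotv q w <= hbar.
    move=> Xw; rewrite dotvZl mulrAC ler_pdivrMr// ler_pM2l//; exact: u_le.
  have Pq : P q by apply: polarXP.
  have PNq : P (- q).
    apply: polarXP => w /XN Xw; rewrite dotvNl -dotvNr; exact: q_polar.
  have := mA q t Pq PNq tT.
  by rewrite dotvZl mulrAC ler_pdivrMr.
have u0 w : X w -> dotv u w = 0.
  by move=> Xw; have := u_le _ Xw; have := u_ge _ Xw; have := u_ge _ (xX t); lra.
by rewrite dotvBr mE dotvZr dotvDr !u0//; lra.
Qed.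

(** With [c := hbar - A / 4], the periodic function [hbar * (m . p) - c * (p . x)] has derivative at
    most [- c * l] off [B], by [normal_center_le]. Over a period this gives [0 <= - c * A], so
    [c <= 0]. The product [p . x] carries out the integration by parts. *)
Lemma action_ge : 0 < A -> 4 * hbar <= A.
Proof.
move=> A0; have [m mX mA] := loop_near_center A0.
pose c := hbar - A / 4.
pose Ca := n%:R * (0 * M + `|m| * C).
pose Cb := n%:R * (C * M + M * C).
have mC : forall s t, `|dotv m (p s) - dotv m (p t)| <= Ca * `|s - t|.
  apply: (dotv_lipschitz (a := fun=> m)) => // ? ?.
  by rewrite subrr normr0 mul0r.
have pxC : forall s t, `|dotv (p s) (x s) - dotv (p t) (x t)| <= Cb * `|s - t|.
  exact: dotv_lipschitz.
have := @lipschitz_le_integral _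
  (fun t => hbar * dotv m (p t) - c * dotv (p t) (x t))
  (fun t => hbar * dotv m (dp t) - c * (dotv (dp t) (x t) + dotv (p t) (dx t)))
  l (hbar * Ca + `|c| * Cb) D (- c) B 0 T (ltW T0) _ mB B0 _ ml lD l0.
rewrite -/A xT pT subrr; have : 0 < A -> 0 <= - c * A -> 4 * hbar <= A.
  by move=> Apos; rewrite pmulr_lge0// /c; lra.
move=> /(_ A0) + h; apply; apply: h.
- move=> s t.
  have -> : hbar * dotv m (p s) - c * dotv (p s) (x s) -
      (hbar * dotv m (p t) - c * dotv (p t) (x t)) =
      hbar * (dotv m (p s) - dotv m (p t)) +
      - c * (dotv (p s) (x s) - dotv (p t) (x t)) by ring.
  rewrite (le_trans (ler_normD _ _))// !normrM normrN (gtr0_norm hbar0) mulrDl.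
  by rewrite -(mulrA hbar) -(mulrA `|c|); apply: lerD; apply: ler_wpM2l => //; exact: ltW.
- move=> t Bt.
  have dmp : is_derive t 1 (fun t => dotv m (p t)) (dotv m (dp t)).
    have := @is_derive_dotv _ _ (fun=> m) p 0 (dp t) t _ (dpE Bt).
    by rewrite dot0v add0r; apply => i; rewrite mxE; exact: is_derive_cst.
  have dpx := is_derive_dotv (dpE Bt) (dxE Bt).
  exact: is_deriveB (is_deriveZ hbar dmp) (is_deriveZ c dpx).
- move=> t Bt tT; rewrite /l /action_density memNset//.
  have := normal_center_le Bt tT mX mA.
  by rewrite dotvBr !dotvNl !(dotvC _ m) /c; lra.
Qed.

End action_bound.

(** * Splitting a closed characteristic of a product into its two loops *)

Section closed_characteristics.
Context {R : realType} {n : nat}.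
Notation mu := (@lebesgue_measure R).
Implicit Types (X P : set 'cV[R]_n) (g : R -> 'cV[R]_(n + n)).

Lemma normr_usubmx_le (z : 'cV[R]_(n + n)) : `|usubmx z| <= `|z|.
Proof.
rewrite [leLHS]/Num.Def.normr/= mx_normrE bigmax_le// => -[i j] _ /=.
by rewrite mxE (ord1 j); exact: normr_coord_le.
Qed.

Lemma normr_dsubmx_le (z : 'cV[R]_(n + n)) : `|dsubmx z| <= `|z|.
Proof.
rewrite [leLHS]/Num.Def.normr/= mx_normrE bigmax_le// => -[i j] _ /=.
by rewrite mxE (ord1 j); exact: normr_coord_le.
Qed.

Lemma dotv_block (u z : 'cV[R]_(n + n)) :
  dotv u z = dotv (usubmx u) (usubmx z) + dotv (dsubmx u) (dsubmx z).
Proof.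
rewrite !dotvE big_split_ord /=.
by congr (_ + _); apply: eq_bigr => i _; rewrite !mxE.
Qed.

Lemma usubmx_Jmx (u : 'cV[R]_(n + n)) : usubmx (Jmx R n *m u) = dsubmx u.
Proof.
by rewrite -[u in LHS]vsubmxK mul_block_col mul0mx mul1mx add0r col_mxKu.
Qed.

Lemma dsubmx_Jmx (u : 'cV[R]_(n + n)) : dsubmx (Jmx R n *m u) = - usubmx u.
Proof.
by rewrite -[u in LHS]vsubmxK mul_block_col !mul0mx addr0 mulNmx mul1mx col_mxKd.
Qed.

Lemma normal_cone_phase_prod X P z u :
  phase_prod X P z -> normal_cone (phase_prod X P) z u <->
  normal_cone X (usubmx z) (usubmx u) /\ normal_cone P (dsubmx z) (dsubmx u).
Proof.
move=> [Xz Pz]; split=> [uN|[ux up] w [Xw Pw]].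
  split=> w Kw.
    have := uN (col_mx w (dsubmx z)).
    rewrite dotv_block !linearB/= col_mxKu col_mxKd subrr [dotv _ 0]dotvC dot0v.
    by rewrite addr0; apply; split; rewrite ?col_mxKu ?col_mxKd.
  have := uN (col_mx (usubmx z) w).
  rewrite dotv_block !linearB/= col_mxKu col_mxKd subrr [dotv _ 0]dotvC dot0v.
  by rewrite add0r; apply; split; rewrite ?col_mxKu ?col_mxKd.
rewrite dotv_block !linearB/=.
by have := ux _ Xw; have := up _ Pw; lra.
Qed.

(** The first conclusion bounds the capacity from below; the second shows that the action of the
    bouncing orbit is positive without computing it. *)
Lemma closed_characteristic_action (hbar M : R) X P g (T : R) : 0 < hbar ->
  (forall y, X y -> X (- y)) -> hpolar hbar X `<=` P ->
  (forall y, X y -> `|y| <= M) -> (forall y, P y -> `|y| <= M) ->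
  closed_characteristic (phase_prod X P) g T ->
  (0 < action g T -> 4 * hbar <= action g T) /\
  (forall q q' s, P q -> P q' -> 0 <= s <= T ->
    dotv q (usubmx (g s) - usubmx (g 0)) + dotv q' (usubmx (g 0) - usubmx (g s))
      <= action g T).
Proof.
move=> hbar0 XN XP XM PM [T0 [gT [gK [[C gC] [_ [N [[B [mB B0 NB]] gD]]]]]]].
pose x t := usubmx (g t); pose p t := dsubmx (g t).
pose dx t := usubmx ('D_1 g t); pose dp t := dsubmx ('D_1 g t).
have xX t : X (x t) by have [[]] := gK t.
have pP t : P (p t) by have [[]] := gK t.
have xC s t : `|x s - x t| <= C * `|s - t|.
  by apply: le_trans (gC s t); rewrite /x -linearB normr_usubmx_le.
have pC s t : `|p s - p t| <= C * `|s - t|.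
  by apply: le_trans (gC s t); rewrite /p -linearB normr_dsubmx_le.
have gt_derive t : ~ B t -> forall i, is_derive t 1 (fun t => g t i 0) ('D_1 g t i 0).
  move=> Bt i; have [|dgt _] := gD t; first by move=> /NB.
  apply: DeriveDef; first by move/derivable_mxP : dgt; apply.
  by rewrite derive_mx// mxE.
have dxE t : ~ B t -> forall i, is_derive t 1 (fun t => x t i 0) (dx t i 0).
  move=> Bt i; rewrite /dx mxE.
  rewrite (_ : (fun t => x t i 0) = (fun t => g t (lshift n i) 0)).
    exact: gt_derive.
  by apply/funext => r; rewrite /x mxE.
have dpE t : ~ B t -> forall i, is_derive t 1 (fun t => p t i 0) (dp t i 0).
  move=> Bt i; rewrite /dp mxE.
  rewrite (_ : (fun t => p t i 0) = (fun t => g t (rshift n i) 0)).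
    exact: gt_derive.
  by apply/funext => r; rewrite /p mxE.
(* For [u = (u_x, u_p)] one has [J u = (u_p, - u_x)]: the velocity of [x] is the normal to [P], and
   minus the velocity of [p] is the normal to [X]. *)
have normals t : ~ B t -> normal_cone X (x t) (- dp t) /\ normal_cone P (p t) (dx t).
  move=> Bt; have [|_ [u uN Du]] := gD t; first by move=> /NB.
  rewrite /dp /dx Du usubmx_Jmx dsubmx_Jmx opprK.
  exact: (normal_cone_phase_prod u (gK t).1).1 uN.
have xM t : `|x t| <= M by exact: XM.
have pM t : `|p t| <= M by exact: PM.
have xT : x T = x 0 by rewrite /x -(gT 0) add0r.
have pT : p T = p 0 by rewrite /p -(gT 0) add0r.
have -> : action g T = \int[mu]_(t in `[0, T]) action_density B p dx t.
  rewrite /action /Rintegral; congr fine.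
  apply: (@integral_off_null _ _ R mu _ B) => // t Bt.
  by rewrite /action_density memNset.
have dxN t (Bt : ~ B t) := (normals t Bt).2.
have dpN t (Bt : ~ B t) := (normals t Bt).1.
split.
  apply: (@action_ge R n hbar T C M B X P x p dx dp) => //.
move=> q q' s Pq Pq' /andP[s0 sT].
exact: (@action_ge_displacements R n T C M B P x p dx).
Qed.

End closed_characteristics.

(** * Ellipsoids and the uncertainty inequality *)

(** With [i] and [k] arbitrary scalars, the expansion is a pure ring identity; it is applied to the
    imaginary unit and ['i * h]. *)
Lemma sesquilinear_expand (K L : comNzRingType) (f : {rmorphism K -> L}) m
    (A B : 'M[K]_m) (u v : 'cV[K]_m) (i k : L)
    (F := fun (x : 'cV[K]_m) (C : 'M[K]_m) y => f ((x^T *m (C *m y)) 0 0)) :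
  (((map_mx f u)^T - i *: (map_mx f v)^T) *m (map_mx f A + k *: map_mx f B)
    *m (map_mx f u + i *: map_mx f v)) 0 0 =
  F u A u - i ^+ 2 * F v A v + i * (F u A v - F v A u)
  + k * (F u B u - i ^+ 2 * F v B v) + k * i * (F u B v - F v B u).
Proof.
have mxD (C D : 'M[L]_1) : (C + D) 0 0 = C 0 0 + D 0 0 by rewrite mxE.
have mxN (C : 'M[L]_1) : (- C) 0 0 = - C 0 0 by rewrite mxE.
have mxZ c (C : 'M[L]_1) : (c *: C) 0 0 = c * C 0 0 by rewrite mxE.
have FE x C y : F x C y = ((map_mx f x)^T *m map_mx f C *m map_mx f y) 0 0.
  by rewrite map_trmx -!map_mxM -mulmxA [RHS]mxE.
rewrite !FE !(mulmxDl, mulmxDr, mulmxBl, mulmxBr) !mulNmx.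
rewrite -?(scalemxAl, scalemxAr) !(mxD, mxN, mxZ); ring.
Qed.

Section quadratic_forms.
Context {R : realType}.

Definition posdefmx m (S : 'M[R]_m) : Prop :=
  S^T = S /\ forall a : 'cV[R]_m, a != 0 -> 0 < dotv a (S *m a).

Lemma dotv_mulmx m (S : 'M[R]_m) (a b : 'cV[R]_m) :
  dotv a (S *m b) = dotv (S^T *m a) b.
Proof. by rewrite /dotv trmx_mul trmxK mulmxA. Qed.

Lemma dotvv_ge0 m (a : 'cV[R]_m) : 0 <= dotv a a.
Proof. by rewrite dotvE sumr_ge0// => i _; rewrite -expr2 sqr_ge0. Qed.

Lemma dotvv_gt0 m (a : 'cV[R]_m) : a != 0 -> 0 < dotv a a.
Proof.
move=> a0; rewrite lt_neqAle dotvv_ge0 andbT eq_sym; apply: contra a0.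
rewrite dotvE psumr_eq0; last by move=> i _; rewrite -expr2 sqr_ge0.
move=> /allP a0; apply/eqP/colP => i; rewrite mxE.
by have := a0 i (mem_index_enum i); rewrite /= mulf_eq0 orbb => /eqP.
Qed.

Lemma posdefmx_ge0 m (S : 'M[R]_m) a : posdefmx S -> 0 <= dotv a (S *m a).
Proof.
move=> [_ S0]; have [->|/S0/ltW//] := eqVneq a 0.
by rewrite dot0v.
Qed.

Lemma posdefmx_unit m (S : 'M[R]_m) : posdefmx S -> S \in unitmx.
Proof.
move=> [St S0]; rewrite -row_free_unit; apply: inj_row_free => v vS.
apply/eqP; apply: contraT => v0.
have := S0 v^T; rewrite trmx_eq0 => /(_ v0).
by rewrite -[S in S *m _]St -trmx_mul vS trmx0 dotvC dot0v ltxx.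
Qed.

(** Test positivity on [a + 'i b] and keep the real part: the cross terms in [S] and the diagonal
    terms in [J] are imaginary, and [('i * h) * 'i = - h]. *)
Lemma herm_psd_real_part m (S J : 'M[R]_m) (h : R) :
  herm_psd (cplx_mx S + ('i * (h%:C)%C) *: cplx_mx J) ->
  forall a b : 'cV[R]_m,
    0 <= dotv a (S *m a) + dotv b (S *m b)
         - h * (dotv a (J *m b) - dotv b (J *m a)).
Proof.
move=> [_ M0] a b.
pose ca := cplx_mx a; pose cb := cplx_mx b.
have := M0 (ca + 'i *: cb).
have -> : adjmx (ca + 'i *: cb) = ca^T - 'i *: cb^T.
  apply/matrixP => i j; rewrite !mxE rmorphD rmorphM /= conjCi mulNr.
  by congr (_ + - (_ * _)); apply/eqP; rewrite eq_complex /= oppr0 !eqxx.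
have := sesquilinear_expand (real_complex R) S J a b 'i ('i * h%:C%C).
rewrite -/ca -/cb => /(congr1 (@complex.Re R)) E.
rewrite lecE => /andP[_]; rewrite [X in _ <= X -> _]E /= /dotv.
lra.
Qed.

(** Antisymmetry of [J] doubles the cross term, turning [hbar / 2] into [hbar]. *)
Lemma herm_psd_Jmx n (S : 'M[R]_(n + n)) (hbar : R) :
  herm_psd (cplx_mx S + ('i * ((hbar / 2)%:C)%C) *: cplx_mx (Jmx R n)) ->
  forall a b : 'cV[R]_(n + n),
    0 <= dotv a (S *m a) + dotv b (S *m b) - hbar * dotv a (Jmx R n *m b).
Proof.
move=> /herm_psd_real_part S0 a b; have := S0 a b.
have -> : dotv b (Jmx R n *m a) = - dotv a (Jmx R n *m b).
  rewrite dotv_mulmx dotvC -dotvNr -mulNmx; congr (dotv _ (_ *m _)).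
  by rewrite /Jmx tr_block_mx !trmx0 linearN /= !trmx1 opp_block_mx !oppr0 opprK.
lra.
Qed.

(** Taking [b = 0] gives semidefiniteness. If [a] were a nonzero isotropic vector, a small multiple
    of [- J a] as second vector would let the negative linear term beat the quadratic one. *)
Lemma herm_psd_posdef n (S : 'M[R]_(n + n)) (hbar : R) : 0 < hbar -> S^T = S ->
  (forall a b : 'cV[R]_(n + n),
    0 <= dotv a (S *m a) + dotv b (S *m b) - hbar * dotv a (Jmx R n *m b)) ->
  posdefmx S.
Proof.
move=> hbar0 St S0; split=> // a a0.
have s0 (b : 'cV[R]_(n + n)) : 0 <= dotv b (S *m b).
  by have := S0 b 0; rewrite !mulmx0 dot0v [dotv b 0]dotvC dot0v; lra.
rewrite lt_neqAle s0 andbT; apply/eqP => Sa0.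
have N0 := dotvv_gt0 a0.
pose b := - (Jmx R n *m a).
have Jb : Jmx R n *m b = a.
  have JJ : Jmx R n *m Jmx R n = - 1%:M.
    rewrite /Jmx mulmx_block !(mul0mx, mulmx0, mul1mx, mulmx1) !(add0r, addr0).
    by rewrite [in RHS]scalar_mx_block opp_block_mx !oppr0.
  by rewrite /b mulmxN mulmxA JJ mulNmx opprK mul1mx.
have hN : 0 < hbar * dotv a a by rewrite mulr_gt0.
(* The added 1 keeps the denominator positive; for this [t], the factor [t * b^T S b - hbar * a^T a]
   equals [- t]. *)
pose t := hbar * dotv a a / (dotv b (S *m b) + 1).
have sb1 : 0 < dotv b (S *m b) + 1 by have := s0 b; lra.
have t0 : 0 < t by rewrite divr_gt0.
have := S0 a (t *: b).
rewrite -Sa0 add0r -!scalemxAr Jb dotvZl !dotvZr.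
have -> : t * (t * dotv b (S *m b)) - hbar * (t * dotv a a) =
    t * (t * dotv b (S *m b) - hbar * dotv a a) by ring.
rewrite pmulr_rge0//.
have := divfK (lt0r_neq0 sb1) (hbar * dotv a a); rewrite -/t; nra.
Qed.

End quadratic_forms.

(** * Convexity and compactness of the ellipsoid and its linear images *)

Section ellipsoids.
Context {R : realType}.

Lemma normr_nonexpansive_continuous (V W : normedModType R) (f : {linear V -> W}) :
  (forall v, `|f v| <= `|v|) -> continuous f.
Proof.
move=> fle v; apply/cvgrPdist_lt => e e0.
near=> w; rewrite -linearB; apply: le_lt_trans (fle _) _.
by near: w; apply: cvgr_dist_lt.
Unshelve. all: by end_near. Qed.

Lemma normr_trmx_le m k (M : 'M[R]_(m, k)) : `|M^T| <= `|M|.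
Proof.
rewrite [leLHS]/Num.Def.normr/= mx_normrE bigmax_le// => -[i j] _ /=.
rewrite mxE [leRHS]/Num.Def.normr/= mx_normrE.
exact: (le_bigmax _ (fun ij => `|M ij.1 ij.2|) (j, i)).
Qed.

Lemma continuous_sumr (T : topologicalType) (I : finType) (f : I -> T -> R) :
  (forall i, continuous (f i)) -> continuous (fun z => \sum_i f i z).
Proof.
move=> cf z; apply: cvg_big; first exact: add_continuous.
by move=> i _; exact: cf.
Qed.

Lemma continuous_mulr (T : topologicalType) (f g : T -> R) :
  continuous f -> continuous g -> continuous (fun z => f z * g z).
Proof. by move=> cf cg z; apply: cvgM; [exact: cf|exact: cg]. Qed.

Lemma continuous_quadratic m (Q : 'M[R]_m) :
  continuous (fun z : 'cV[R]_m => dotv z (Q *m z)).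
Proof.
rewrite (_ : (fun z => _) = fun z : 'cV[R]_m => \sum_i z i 0 * \sum_j Q i j * z j 0).
  apply: continuous_sumr => i; apply: continuous_mulr; first exact: coord_continuous.
  apply: continuous_sumr => j; apply: continuous_mulr; last exact: coord_continuous.
  exact: cst_continuous.
apply/funext => z; rewrite dotvE; apply: eq_bigr => i _.
by rewrite mxE.
Qed.

Context {n : nat} (S : 'M[R]_(n + n)).
Hypothesis S_posdef : posdefmx S.

Lemma OmegaE (z : 'cV[R]_(n + n)) : Omega S z <-> dotv z (invmx S *m z) <= 2.
Proof.
rewrite /dotv mulmxA; set q := (_ *m _) 0 0.
by split=> [Oz|qz]; [have : 2^-1 * q <= 1 by exact: Oz|change (2^-1 * q <= 1)]; lra.
Qed.

(** Writing points of the ellipsoid as [S w] eliminates the inverse matrix. *)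
Lemma Omega_mulmx (w : 'cV[R]_(n + n)) : Omega S (S *m w) <-> dotv w (S *m w) <= 2.
Proof.
have -> : dotv w (S *m w) = dotv (S *m w) (invmx S *m (S *m w)).
  by rewrite mulKmx ?posdefmx_unit// dotvC.
exact: OmegaE.
Qed.

Lemma posdefmx_inv : posdefmx (invmx S).
Proof.
have [St S0] := S_posdef; have Su := posdefmx_unit S_posdef.
split=> [|a a0]; first by rewrite trmx_inv St.
rewrite -[a in dotv a _](mulKVmx Su) dotvC; apply: S0.
by apply: contra a0 => /eqP a0; rewrite -[a](mulKVmx Su) a0 mulmx0.
Qed.

(** For the quadratic form [q] of [invmx S], the convexity defect [t q(x) + (1 - t) q(y) - q(t x +
    (1 - t) y)] equals [t (1 - t) q(x - y)]. *)
Lemma Omega_convex : Defs.convex_set (Omega S).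
Proof.
move=> x y Ox Oy t /andP[t0 t1]; apply: (OmegaE _).2.
have xO := (OmegaE x).1 Ox; have yO := (OmegaE y).1 Oy.
have xy := posdefmx_ge0 (x - y) posdefmx_inv.
set Q := invmx S in xO yO xy *.
have cross : dotv x (Q *m y) = dotv y (Q *m x).
  by rewrite dotv_mulmx (posdefmx_inv.1) dotvC.
move: xy; rewrite !mulmxDr !mulmxN -!scalemxAr.
rewrite !(dotvDl, dotvDr, dotvNl, dotvNr, dotvZl, dotvZr) cross => xy.
have h1 : 0 <= (1 - t) by lra.
have h2 := mulr_ge0 (mulr_ge0 t0 h1) xy.
have h3 : t * dotv x (Q *m x) <= t * 2 by rewrite ler_wpM2l.
have h4 : (1 - t) * dotv y (Q *m y) <= (1 - t) * 2 by rewrite ler_wpM2l.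
nra.
Qed.

Lemma Omega_opp z : Omega S z -> Omega S (- z).
Proof.
move=> Oz; apply: (OmegaE _).2; rewrite mulmxN dotvNl dotvNr opprK.
exact: (OmegaE z).1.
 Qed.

(* Expanding [(e_i - w)^T S (e_i - w) >= 0] for [z = S w] bounds the i-th
   coordinate of [z]. *)
Lemma Omega_bounded : exists M : R, forall z, Omega S z -> `|z| <= M.
Proof.
have S_delta i (w : 'cV[R]_(n + n)) : dotv (delta_mx i 0) (S *m w) = (S *m w) i 0.
  by rewrite /dotv trmx_delta -rowE mxE.
have Sii i : S i i = dotv (delta_mx i 0) (S *m delta_mx i 0).
  by rewrite S_delta -colE mxE.
have Sii2 i : 0 <= S i i + 2 by rewrite addr_ge0// Sii posdefmx_ge0.
exists (\sum_i (S i i + 2)) => z Oz.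
rewrite [leLHS]/Num.Def.normr/= mx_normrE bigmax_le ?sumr_ge0// => -[i j] _ /=.
rewrite (ord1 j) (bigD1 i)//=; apply: (@le_trans _ _ (S i i + 2)); last first.
  by rewrite lerDl sumr_ge0.
pose w := invmx S *m z.
have zE : z = S *m w by rewrite mulKVmx// posdefmx_unit.
have wz : dotv w z <= 2 by rewrite zE; apply: (Omega_mulmx w).1; rewrite -zE.
have sym : dotv w (S *m delta_mx i 0) = z i 0.
  by rewrite dotv_mulmx S_posdef.1 dotvC S_delta zE.
have Sii0 : 0 <= S i i by rewrite Sii posdefmx_ge0.
have := posdefmx_ge0 (delta_mx i 0 + w) S_posdef.
have := posdefmx_ge0 (delta_mx i 0 - w) S_posdef.
rewrite !mulmxDr !mulmxN !(dotvDl, dotvDr, dotvNl, dotvNr) -!Sii !S_delta -!zE !sym.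
by move=> h1 h2; rewrite ler_norml; apply/andP; split; lra.
Qed.

Lemma Omega_nbhs0 : \forall z \near (0 : 'cV[R]_(n + n)), Omega S z.
Proof.
have q0 := @continuous_quadratic _ (invmx S) 0.
have : dotv 0 (invmx S *m 0) < 2 by rewrite dot0v.
move=> /(cvgr_lt _ q0); apply: filterS => z z2.
by apply: (OmegaE z).2; exact: ltW.
Qed.

Lemma Omega_closed : closed (Omega S).
Proof.
rewrite (_ : Omega S = (fun z : 'cV[R]_(n + n) => dotv z (invmx S *m z)) @^-1`
    [set x | x <= 2]).
  apply: closed_comp; first by move=> z _; exact: continuous_quadratic.
  exact: closed_le.
by apply/seteqP; split=> z; [exact: (OmegaE z).1|exact: (OmegaE z).2].
Qed.

Lemma Omega_compact : compact (Omega S).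
Proof.
have trmx_continuous m k : continuous (@trmx R m k).
  apply: (@normr_nonexpansive_continuous _ _ (@trmx R m k)) => M.
  exact: normr_trmx_le.
(* Closed bounded sets of row vectors are compact; continuity of the transpose carries this over to
   columns. *)
pose A : set 'rV[R]_(n + n) := trmx @^-1` Omega S.
have -> : Omega S = trmx @` A.
  apply/seteqP; split=> [z Oz|z [v Av <-]]; last exact: Av.
  by exists z^T; rewrite /A /= trmxK.
apply: continuous_compact; first exact/continuous_subspaceT/trmx_continuous.
apply: bounded_closed_compact.
  have [M OM] := Omega_bounded.
  exists M; split=> [|N MN v /OM vM]; first exact: num_real.
  apply: le_trans (ltW MN); apply: le_trans vM.
  by rewrite -[v in leLHS]trmxK normr_trmx_le.
apply: closed_comp; first by move=> v _; exact: trmx_continuous.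
exact: Omega_closed.
Qed.

(** The section [g] provides the interior point: the preimage of the ellipsoid under [g] is a
    neighborhood of 0 inside the image under [f]. *)
Lemma linear_image_Omega (f : {linear 'cV[R]_(n + n) -> 'cV[R]_n})
    (g : {linear 'cV[R]_n -> 'cV[R]_(n + n)}) :
  (forall z, `|f z| <= `|z|) -> (forall x, `|g x| <= `|x|) -> cancel g f ->
  sym_convex_body (f @` Omega S).
Proof.
move=> fle gle gK.
have cf := normr_nonexpansive_continuous fle.
have cg := normr_nonexpansive_continuous gle.
split; last by move=> _ [z Oz <-]; exists (- z); rewrite ?linearN//; exact: Omega_opp.
split; first by apply: continuous_compact; [exact: continuous_subspaceT|exact: Omega_compact].
split.
  move=> _ _ [z Oz <-] [w Ow <-] t t01; exists (t *: z + (1 - t) *: w).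
    exact: Omega_convex.
  by rewrite linearD !linearZ.
exists 0; rewrite /interior /=.
have cg0 := cg 0; rewrite /continuous_at linear0 in cg0.
have : nbhs (0 : 'cV[R]_n) (g @^-1` Omega S) by exact: cg0 _ Omega_nbhs0.
apply: filterS => x Ox.
by exists (g x); rewrite ?gK.
Qed.

End ellipsoids.

(** * The two projections of the ellipsoid and their polarity *)

Section quantum_pair_of_covariance.
Context {R : realType} {n : nat} (S : 'M[R]_(n + n)).
Hypothesis S_posdef : posdefmx S.

Lemma normr_col_mx_le (x p : 'cV[R]_n) (M : R) :
  `|x| <= M -> `|p| <= M -> `|col_mx x p| <= M.
Proof.
move=> xM pM; rewrite [leLHS]/Num.Def.normr/= mx_normrE bigmax_le//=.
  exact: le_trans xM.
move=> [i j] _ /=; rewrite (ord1 j); case: (split_ordP i) => k -> /=.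
  by rewrite col_mxEu (le_trans (normr_coord_le _ _)).
by rewrite col_mxEd (le_trans (normr_coord_le _ _)).
Qed.

Lemma projX_sym_convex_body : sym_convex_body (projX (Omega S)).
Proof.
have -> : projX (Omega S) = usubmx @` Omega S.
  apply/seteqP; split=> [x [p Oxp]|_ [z Oz <-]].
    by exists (col_mx x p); rewrite ?col_mxKu.
  by exists (dsubmx z); rewrite vsubmxK.
pose g : 'M[R]_(n + n, n) := col_mx 1%:M 0.
have gE (x : 'cV[R]_n) : g *m x = col_mx x 0.
  by rewrite mul_col_mx mul1mx mul0mx.
apply: (@linear_image_Omega _ _ _ S_posdef usubmx (mulmx g)) => [z|x|x].
- exact: normr_usubmx_le.
- by rewrite /= gE; apply: normr_col_mx_le; rewrite ?normr0.
- by rewrite /= gE col_mxKu.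
Qed.

Lemma projP_sym_convex_body : sym_convex_body (projP (Omega S)).
Proof.
have -> : projP (Omega S) = dsubmx @` Omega S.
  apply/seteqP; split=> [p [x Oxp]|_ [z Oz <-]].
    by exists (col_mx x p); rewrite ?col_mxKd.
  by exists (usubmx z); rewrite vsubmxK.
pose g : 'M[R]_(n + n, n) := col_mx 0 1%:M.
have gE (x : 'cV[R]_n) : g *m x = col_mx 0 x.
  by rewrite mul_col_mx mul1mx mul0mx.
apply: (@linear_image_Omega _ _ _ S_posdef dsubmx (mulmx g)) => [z|x|x].
- exact: normr_dsubmx_le.
- by rewrite /= gE; apply: normr_col_mx_le; rewrite ?normr0.
- by rewrite /= gE col_mxKd.
Qed.

Lemma drsubmx_posdef : posdefmx (drsubmx S).
Proof.
split=> [|v v0]; first by rewrite trmx_drsub S_posdef.1.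
have := S_posdef.2 (col_mx 0 v).
rewrite col_mx_eq0 negb_and v0 orbT => /(_ isT).
rewrite dotv_block col_mxKu col_mxKd dot0v add0r.
by rewrite -[S in S *m _]submxK mul_block_col col_mxKd mulmx0 add0r.
Qed.

(* With [B := (p, 0)^T S (p, 0)], polarity means [2 B <= hbar^2]. For
   [b := (0, D^-1 p)], where [D] is the momentum block of [S], the uncertainty
   inequality for the pair [((p, 0) * d / hbar, b)] with [d := b^T S b]
   becomes [(d / hbar)^2 * B + d - d^2 >= 0], which forces [d <= 2]. *)
Lemma hpolar_projX_subset (hbar : R) : 0 < hbar ->
  (forall a b : 'cV[R]_(n + n),
    0 <= dotv a (S *m a) + dotv b (S *m b) - hbar * dotv a (Jmx R n *m b)) ->
  hpolar hbar (projX (Omega S)) `<=` projP (Omega S).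
Proof.
move=> hbar0 uncert p p_polar.
pose a : 'cV[R]_(n + n) := col_mx p 0.
pose B := dotv a (S *m a).
have B0 : 0 <= B := posdefmx_ge0 a S_posdef.
have dot_a (z : 'cV[R]_(n + n)) : dotv a z = dotv p (usubmx z).
  by rewrite dotv_block col_mxKu col_mxKd dot0v addr0.
have B_le : 2 * B <= hbar ^+ 2.
  have [->|Bneq0] := eqVneq B 0; first by rewrite mulr0 sqr_ge0.
  have Bgt0 : 0 < B by rewrite lt_neqAle eq_sym Bneq0.
  (* This scaling puts [c *: (S *m a)] on the boundary of the ellipsoid; polarity is tested on its
     position part. *)
  pose c := Num.sqrt (2 / B).
  have c2 : c ^+ 2 * B = 2 by rewrite sqr_sqrtr ?divfK// divr_ge0.
  have c0 : 0 <= c := sqrtr_ge0 _.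
  have cB_le : c * B <= hbar.
    rewrite /B dot_a -dotvZr -linearZ /=; apply: p_polar.
    exists (dsubmx (c *: (S *m a))); rewrite vsubmxK scalemxAr.
    apply: (Omega_mulmx S_posdef _).2.
    by rewrite -scalemxAr dotvZl dotvZr -/B mulrA -expr2 c2.
  have : (c * B) ^+ 2 <= hbar ^+ 2.
    by rewrite ler_sqr ?nnegrE ?mulr_ge0// ltW.
  by rewrite exprMn [B ^+ 2]expr2 mulrA c2.
pose v := invmx (drsubmx S) *m p.
have Dv : drsubmx S *m v = p by rewrite mulKVmx// posdefmx_unit// ; exact: drsubmx_posdef.
pose b : 'cV[R]_(n + n) := col_mx 0 v.
have Sb : dsubmx (S *m b) = p.
  by rewrite -[S]submxK mul_block_col col_mxKd mulmx0 add0r.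
pose d := dotv b (S *m b).
have d0 : 0 <= d := posdefmx_ge0 b S_posdef.
have dE : d = dotv p v.
  by rewrite /d dotv_block col_mxKu col_mxKd dot0v add0r Sb dotvC.
have aJb : dotv a (Jmx R n *m b) = d by rewrite dot_a usubmx_Jmx col_mxKd dE.
(* The momentum part of [S *m b] is [p], and [d <= 2] places this point in the ellipsoid. *)
suff d2 : d <= 2.
  exists (usubmx (S *m b)); rewrite -[X in col_mx _ X]Sb vsubmxK.
  by apply: (Omega_mulmx S_posdef _).2.
have := uncert ((d / hbar) *: a) b.
rewrite -scalemxAr !dotvZl dotvZr aJb -/B -/d.
have h0 : hbar != 0 by rewrite gt_eqF.
have dh : d / hbar * hbar = d by rewrite divfK.
set k := d / hbar in dh *.
have k0 : 0 <= k by rewrite divr_ge0// ltW.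
(* Inserted in the uncertainty inequality, this leaves [d - d^2 / 2 >= 0], which is false for
   [d > 2]. *)
have : k * (k * B) * 2 <= d ^+ 2.
  rewrite -dh exprMn mulrA -expr2 -mulrA ler_wpM2l ?sqr_ge0// mulrC//.
move=> h1 h2; rewrite leNgt; apply/negP => d2; nra.
Qed.

End quantum_pair_of_covariance.

(** * Existence of a closed characteristic *)

Section closed_characteristic_existence.
Context {R : realType}.

(** The first-order remainder is at most [h ^+ 2] even when [s] and [h + s] have opposite signs. *)
Lemma is_derive_mulr_norm (s : R) : is_derive s 1 (fun s => s * `|s|) (2 * `|s|).
Proof.
have key h : `|(h + s) * `|h + s| - s * `|s| - h * (2 * `|s|)| <= h ^+ 2.
  rewrite ler_norml.
  by case: (ger0P s) => s0; case: (ger0P (h + s)) => hs0; apply/andP; split; nra.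
have lim : h^-1 *: ((h *: (1 : R) + s) * `|h *: (1 : R) + s| - s * `|s|)
    @[h --> 0^'] --> 2 * `|s|.
  apply/cvgrPdist_le => e e0; near=> h.
  have h0 : h != 0 by near: h; exact: nbhs_dnbhs_neq.
  have he : `|h| <= e by near: h; exact: dnbhs0_le.
  have -> : h *: (1 : R) = h by exact: mulr1.
  rewrite distrC; apply: le_trans he.
  have -> : h^-1 *: ((h + s) * `|h + s| - s * `|s|) - 2 * `|s| =
      h^-1 * ((h + s) * `|h + s| - s * `|s| - h * (2 * `|s|)).
    by rewrite [in RHS]mulrBr mulKf.
  rewrite normrM normfV ler_pdivrMl ?normr_gt0//.
  by rewrite -expr2 real_normK ?num_real//; exact: key.
apply: DeriveDef; first by apply/cvg_ex; exists (2 * `|s|).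
exact: cvg_lim lim.
Unshelve. all: by end_near. Qed.

(* Second difference of [s * `|s| / 2], an antiderivative of [`|s|]. *)
Definition smooth_clamp (s : R) : R :=
  ((s + 1) * `|s + 1| - 2 * (s * `|s|) + (s - 1) * `|s - 1|) / 2.

(** The tent function of height 2 supported on [[-1, 1]]. *)
Definition smooth_clamp' (s : R) : R := `|s + 1| - 2 * `|s| + `|s - 1|.

Lemma is_derive_smooth_clamp (s : R) : is_derive s 1 smooth_clamp (smooth_clamp' s).
Proof.
have sh (c : R) : is_derive s 1 (fun s : R => (s + c) * `|s + c|) (2 * `|s + c|).
  rewrite -[2 * _]mulr1.
  exact: (@is_derive1_comp R (fun s => s * `|s|) (shift c) s _ _
    (is_derive_mulr_norm (s + c)) (is_derive_shift s 1 c)).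
have := is_deriveZ 2^-1 (is_deriveD (is_deriveB (sh 1)
  (is_deriveZ 2 (is_derive_mulr_norm s))) (sh (-1))).
rewrite (_ : (_ \*: _) = smooth_clamp); last first.
  by apply/funext => r; rewrite /smooth_clamp mulrC.
by move/is_derive_eq; apply; rewrite /smooth_clamp' /GRing.scale/=; lra.
Qed.

Lemma smooth_clamp_ge1 s : 1 <= s -> smooth_clamp s = 1 /\ smooth_clamp' s = 0.
Proof.
move=> s1; rewrite /smooth_clamp /smooth_clamp'.
by rewrite !ger0_norm; [split; lra| lra..].
Qed.

Lemma smooth_clamp_leN1 s : s <= -1 -> smooth_clamp s = -1 /\ smooth_clamp' s = 0.
Proof.
move=> s1; rewrite /smooth_clamp /smooth_clamp'.
by rewrite !ler0_norm; [split; lra| lra..].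
Qed.

Lemma smooth_clamp'_itv s : 0 <= smooth_clamp' s <= 2.
Proof.
rewrite /smooth_clamp'.
case: (ger0P (s + 1)) => ?; case: (ger0P s) => ?; case: (ger0P (s - 1)) => ?;
  by apply/andP; split; lra.
Qed.

Lemma smooth_clamp_itv s : `|smooth_clamp s| <= 1.
Proof.
rewrite ler_norml /smooth_clamp.
case: (ger0P (s + 1)) => ?; case: (ger0P s) => ?; case: (ger0P (s - 1)) => ?;
  by apply/andP; split; nra.
Qed.

Lemma smooth_clamp0 : smooth_clamp 0 = 0.
Proof.
by rewrite /smooth_clamp add0r normr1 normr0 sub0r normrN normr1; lra.
Qed.

Lemma derive_le_lipschitz (f df : R -> R) (C : R) :
  (forall t : R, is_derive t 1 f (df t)) -> (forall t, `|df t| <= C) ->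
  forall s t, `|f s - f t| <= C * `|s - t|.
Proof.
move=> fdf dfC.
have le s t : s <= t -> `|f s - f t| <= C * `|s - t|.
  move=> st; have cf : {within `[s, t], continuous f}.
    apply: continuous_subspaceT => r; apply/differentiable_continuous.
    by apply/derivable1_diffP; case: (fdf r).
  have [c _ ftE] := @MVT_segment R f df s t st (fun r _ => fdf r) cf.
  by rewrite distrC ftE normrM [`|s - t|]distrC ler_wpM2r.
by move=> s t; have [/le//|/ltW/le] := leP s t; rewrite distrC [`|t - s|]distrC.
Qed.

(* At each time one of the two coordinates of the loop
   [(smooth_clamp (sqrt 2 * sin t), smooth_clamp (sqrt 2 * cos t))]
   is stationary at [1] or [-1], since [sin^2 + cos^2 = 1]. *)
Lemma square_loop : exists a b da db : R -> R,
  [/\ forall t : R, is_derive t 1 a (da t) /\ is_derive t 1 b (db t),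
      forall t, `|da t| <= 4 /\ `|db t| <= 4,
      forall t, `|a t| <= 1 /\ `|b t| <= 1,
      forall t, a (t + pi *+ 2) = a t /\ b (t + pi *+ 2) = b t &
      [/\ forall t, `|a t| = 1 \/ `|b t| = 1,
          forall t, da t != 0 -> `|b t| = 1 /\ 0 <= b t * da t,
          forall t, db t != 0 -> `|a t| = 1 /\ a t * db t <= 0,
          a 0 = 0 & a (pi / 2) = 1]].
Proof.
(* With this factor the squares of the two arguments add up to 2, so at least one argument has
   absolute value at least 1, where the clamp is flat. *)
pose c : R := Num.sqrt 2.
have c2 : c ^+ 2 = 2 by rewrite sqr_sqrtr.
have c0 : 0 <= c := sqrtr_ge0 _.
have c1 : 1 <= c by nra.
have cle2 : c <= 2 by nra.
pose phi := smooth_clamp; pose dphi := smooth_clamp'.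
exists (fun t => phi (c * sin t)), (fun t => phi (c * cos t)).
exists (fun t => dphi (c * sin t) * (c * cos t)).
exists (fun t => dphi (c * cos t) * (c * - sin t)).
have sc t : (c * sin t) ^+ 2 + (c * cos t) ^+ 2 = 2.
  by rewrite !exprMn -mulrDr addrC cos2Dsin2 c2 mulr1.
have bnd (u v : R) : `|v| <= 1 -> `|dphi u * (c * v)| <= 4.
  move=> v1; have /andP[d0 d2] := smooth_clamp'_itv u.
  rewrite !normrM (ger0_norm d0) (ger0_norm c0).
  have -> : 4 = 2 * (2 * 1) :> R by lra.
  by rewrite !ler_pM// mulr_ge0.
have sin1 (t : R) : `|sin t| <= 1 by rewrite ler_norml sin_geN1 sin_le1.
have cos1 (t : R) : `|cos t| <= 1 by rewrite ler_norml cos_geN1 cos_le1.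
(* If the clamp moves at [u], then [u ^+ 2 < 1], so [v ^+ 2 > 1] and the clamp of [v] is the sign of
   [v]. *)
have dich (u v : R) : u ^+ 2 + v ^+ 2 = 2 -> dphi u != 0 ->
    `|phi v| = 1 /\ 0 <= phi v * v.
  move=> uv du0; have [v1|v1] := leP 1 v.
    by rewrite /phi (smooth_clamp_ge1 v1).1 normr1; split=> //; lra.
  have [vN1|vN1] := leP v (-1).
    by rewrite /phi (smooth_clamp_leN1 vN1).1 normrN normr1; split=> //; lra.
  have [u1|u1] := leP 1 u.
    by move: du0; rewrite /dphi (smooth_clamp_ge1 u1).2 eqxx.
  have [uN1|uN1] := leP u (-1).
    by move: du0; rewrite /dphi (smooth_clamp_leN1 uN1).2 eqxx.
  by exfalso; nra.
have dphi0 u := (andP (smooth_clamp'_itv u)).1.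
split.
- move=> t; split.
    exact: (@is_derive1_comp R smooth_clamp (fun t => c * sin t) t _ _
      (is_derive_smooth_clamp (c * sin t))
      (is_deriveZ c (is_derive_sin t))).
  exact: (@is_derive1_comp R smooth_clamp (fun t => c * cos t) t _ _
      (is_derive_smooth_clamp (c * cos t))
    (is_deriveZ c (is_derive_cos t))).
- by move=> t; split; apply: bnd; rewrite ?normrN.
- by move=> t; split; exact: smooth_clamp_itv.
- by move=> t; rewrite sinD2pi cosD2pi.
split.
- move=> t; have [u0|u0] := eqVneq (dphi (c * cos t)) 0; last first.
    by left; apply: (dich _ _ _ u0).1; rewrite addrC.
  have [v1|v1] := leP 1 (c * cos t).
    by right; rewrite /phi (smooth_clamp_ge1 v1).1 normr1.
  have [vN1|vN1] := leP (c * cos t) (-1).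
    by right; rewrite /phi (smooth_clamp_leN1 vN1).1 normrN normr1.
  exfalso; move: u0; rewrite /dphi /smooth_clamp'.
  rewrite [`|_ + 1|]ger0_norm ?[`|_ - 1|]ler0_norm; [|lra..].
  by case: (ger0P (c * cos t)) => ? /eqP; lra.
- move=> t /eqP da0.
  have [|->] := dich _ _ (sc t).
    by apply/eqP => d0; apply: da0; rewrite d0 mul0r.
  by move=> ?; split=> //; rewrite mulrCA mulr_ge0.
- move=> t /eqP db0.
  have [||->] := dich (c * cos t) (c * sin t).
  + by rewrite addrC.
  + by apply/eqP => d0; apply: db0; rewrite d0 mul0r.
  move=> ?; split=> //; rewrite mulrN mulrN mulrN oppr_le0 mulrCA mulr_ge0//.
- by rewrite sin0 mulr0 /phi smooth_clamp0.
- by rewrite sin_pihalf mulr1 /phi (smooth_clamp_ge1 c1).1.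
Qed.

End closed_characteristic_existence.

(** * A closed characteristic bouncing between opposite boundary points *)

Section bouncing_orbit.
Context {R : realType} {n : nat}.
Implicit Types (X P : set 'cV[R]_n).

Lemma interior_ray m (K : set 'cV[R]_m) z v : interior K z ->
  exists2 e : R, 0 < e & K (z + e *: v).
Proof.
move=> Kz.
have cf : (fun e : R => z + e *: v) @ (0 : R) --> z.
  rewrite -[X in _ --> X]addr0 -[X in _ + X](scale0r v).
  by apply: cvgD; [exact: cvg_cst|apply: cvgZl; exact: cvg_id].
have /nbhs_ballP[e /= e0 eK] := cf _ Kz.
exists (e / 2); first by rewrite divr_gt0.
apply: eK; rewrite /ball/= sub0r normrN gtr0_norm ?divr_gt0//.
by rewrite ltr_pdivrMr// ltr_pMr// ltr1n.
Qed.

(** From an interior point, a small step along [u] would stay in [K] while increasing the product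
    with [u]. *)
Lemma normal_cone_not_interior m (K : set 'cV[R]_m) z u :
  normal_cone K z u -> u != 0 -> ~ interior K z.
Proof.
move=> uN u0 /(interior_ray u)[e e0 /uN].
rewrite addrAC subrr add0r dotvZr leNgt => /negP; apply.
by rewrite mulr_gt0// dotvv_gt0.
Qed.

(** Averaging [z + e *: v] with [- z], for an interior point [z], cancels [z]. *)
Lemma sym_convex_body_ray X (v : 'cV[R]_n) : sym_convex_body X ->
  exists2 e : R, 0 < e & X (e *: v).
Proof.
move=> [[_ [cX [z Xz]]] XN].
have [e e0 Xe] := interior_ray v Xz.
exists (2^-1 * e); first by rewrite mulr_gt0// invr_gt0.
have := cX _ _ Xe (XN _ (interior_subset Xz)) 2^-1.
have -> : 2^-1 *: (z + e *: v) + (1 - 2^-1) *: - z = (2^-1 * e) *: v.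
  have -> : 1 - 2^-1 = 2^-1 :> R by lra.
  by rewrite scalerN scalerDr addrAC subrr add0r scalerA.
by apply; apply/andP; split; lra.
Qed.

(** Compactness of [X * P] yields a joint maximizer. The maximum is positive because, for [n >= 1],
    both bodies contain a positive multiple of one nonzero vector. *)
Lemma dotv_maximizers X P : (1 <= n)%N ->
  sym_convex_body X -> sym_convex_body P ->
  exists x p, [/\ X x, P p, 0 < dotv p x,
    forall y, X y -> dotv p y <= dotv p x & forall q, P q -> dotv q x <= dotv p x].
Proof.
move=> n1 bX bP.
pose v : 'cV[R]_n := delta_mx (Ordinal n1) 0.
have v0 : v != 0.
  apply/eqP => /colP/(_ (Ordinal n1)) /eqP.
  by rewrite !mxE !eqxx oner_eq0.
have [e e0 Xe] := sym_convex_body_ray v bX.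
have [d d0 Pd] := sym_convex_body_ray v bP.
pose F (z : 'cV[R]_n * 'cV[R]_n) := dotv z.2 z.1.
have cF : continuous F.
  rewrite (_ : F = fun z => \sum_i z.2 i 0 * z.1 i 0); last first.
    by apply/funext => z; exact: dotvE.
  apply: continuous_sumr => i; apply: continuous_mulr => z.
    apply: (@continuous_comp _ _ _ snd (fun M : 'cV[R]_n => M i 0)).
      exact: cvg_snd.
    exact: coord_continuous.
  apply: (@continuous_comp _ _ _ fst (fun M : 'cV[R]_n => M i 0)).
    exact: cvg_fst.
  exact: coord_continuous.
have [||[x p]] := @compact_EVT_max _ R F (X `*` P) (ex_intro _ (e *: v, d *: v) (conj Xe Pd)).
- by apply: compact_setX; [case: bX => -[]|case: bP => -[]].
- exact: continuous_subspaceT.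
rewrite inE => -[/= Xx Pp] Fmax; exists x, p; split=> //.
- apply: (@lt_le_trans _ _ (dotv (d *: v) (e *: v))).
    by rewrite dotvZl dotvZr !mulr_gt0// dotvv_gt0.
  by apply: (Fmax (e *: v, d *: v)); rewrite inE.
- by move=> y Xy; apply: (Fmax (y, p)); rewrite inE.
- by move=> q Pq; apply: (Fmax (x, q)); rewrite inE.
Qed.

(* With [(x, p)] maximizing [p . x] on [X * P], the vector [p] is an outer normal
   of [X] at [x] and [x] is an outer normal of [P] at [p]: the characteristic
   bounces between [x] and [- x] with momentum [p] or [- p]. *)
Lemma bouncing_closed_characteristic X P : (1 <= n)%N ->
  sym_convex_body X -> sym_convex_body P ->
  exists g T p s, [/\ closed_characteristic (phase_prod X P) g T,
    P p, P (- p), 0 <= s <= T &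
    0 < dotv p (usubmx (g s) - usubmx (g 0)) +
        dotv (- p) (usubmx (g 0) - usubmx (g s))].
Proof.
move=> n1 bX bP.
have [x [p [Xx Pp px0 pmax xmax]]] := dotv_maximizers n1 bX bP.
have XN := bX.2; have PN := bP.2.
have x0 : x != 0 by apply: contraTneq px0 => ->; rewrite dotvC dot0v ltxx.
have p0 : p != 0 by apply: contraTneq px0 => ->; rewrite dot0v ltxx.
have [a [b [da [db [ab_derive dab_le ab_le ab_periodic]]]]] := @square_loop R.
move=> [ab1 da_b db_a a0 a1].
have pmaxN y : X y -> - dotv p y <= dotv p x.
  by move=> /XN/pmax; rewrite dotvNr.
have xmaxN q : P q -> - dotv q x <= dotv p x.
  by move=> /PN/xmax; rewrite dotvNl.
have scaled (c M r : R) : - r <= M -> r <= M -> `|c| <= 1 -> c * r <= M.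
  move=> r1 r2 c1; apply: (le_trans (ler_norm _)); rewrite normrM.
  have : `|r| <= M by rewrite ler_norml; apply/andP; split; lra.
  by have := normr_ge0 c; have := normr_ge0 r; nra.
have Xa t : X (a t *: x).
  have [/andP[l u] _] : -1 <= a t <= 1 /\ True.
    by split=> //; rewrite -ler_norml; exact: (ab_le t).1.
  have := bX.1.2.1 x (- x) Xx (XN _ Xx) ((1 + a t) / 2).
  have -> : ((1 + a t) / 2) *: x + (1 - (1 + a t) / 2) *: - x = a t *: x.
    by rewrite scalerN -scaleNr -scalerDl; congr (_ *: _); lra.
  by apply; apply/andP; split; lra.
have Pb t : P (b t *: p).
  have [/andP[l u] _] : -1 <= b t <= 1 /\ True.
    by split=> //; rewrite -ler_norml; exact: (ab_le t).2.
  have := bP.1.2.1 p (- p) Pp (PN _ Pp) ((1 + b t) / 2).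
  have -> : ((1 + b t) / 2) *: p + (1 - (1 + b t) / 2) *: - p = b t *: p.
    by rewrite scalerN -scaleNr -scalerDl; congr (_ *: _); lra.
  by apply; apply/andP; split; lra.
have sq1 (c : R) : `|c| = 1 -> c * c = 1.
  by move=> c1; rewrite -expr2 -real_normK ?num_real// c1 expr1n.
(* At an end [a t *: x] of the segment, [a t *: p] is an outer normal by maximality and symmetry,
   hence so is [k *: p] when [k] is 0 or has the sign of [a t]. *)
have normalX t k : `|a t| = 1 -> 0 <= a t * k -> normal_cone X (a t *: x) (k *: p).
  move=> at1 ak y Xy; rewrite dotvZl dotvBr dotvZr.
  have -> : k * (dotv p y - a t * dotv p x) =
      (a t * k) * (a t * dotv p y - (a t * a t) * dotv p x).
    by rewrite -[k in LHS]mul1r -(sq1 _ at1); ring.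
  rewrite sq1// mul1r mulr_ge0_le0// subr_le0.
  by apply: scaled; rewrite ?at1//; [exact: pmaxN|exact: pmax].
have normalP t k : `|b t| = 1 -> 0 <= b t * k -> normal_cone P (b t *: p) (k *: x).
  move=> bt1 bk q Pq; rewrite dotvZl dotvBr dotvZr ![dotv x _]dotvC.
  have -> : k * (dotv q x - b t * dotv p x) =
      (b t * k) * (b t * dotv q x - (b t * b t) * dotv p x).
    by rewrite -[k in LHS]mul1r -(sq1 _ bt1); ring.
  rewrite sq1// mul1r mulr_ge0_le0// subr_le0.
  by apply: scaled; rewrite ?bt1//; [exact: xmaxN|exact: xmax].
have zero_normal (K : set 'cV[R]_n) z : normal_cone K z 0.
  by move=> w _; rewrite dot0v.
(* Position moves while the momentum rests at [p] or [- p]; momentum moves while the position rests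
   at [x] or [- x]. *)
pose g t := col_mx (a t *: x) (b t *: p).
have gK t : phase_prod X P (g t) by split; rewrite ?col_mxKu ?col_mxKd.
(* Between times 0 and [pi / 2] the position goes from 0 to [x], so the last quantity is
   [2 * (p . x)]. *)
exists g, (pi *+ 2), p, (pi / 2).
have pi0 : 0 < pi :> R := pi_gt0 R.
have two_pi : pi *+ 2 = 2 * pi :> R by rewrite mulr_natl.
split; [|exact: Pp|exact: PN| |]; last 2 first.
- by rewrite two_pi; apply/andP; split; lra.
- rewrite /g !col_mxKu a0 a1 scale1r scale0r subr0 sub0r dotvNl dotvNr opprK.
  by rewrite addr_gt0.
split; first by rewrite two_pi; lra.
split; first by move=> t; rewrite /g (ab_periodic t).1 (ab_periodic t).2.
split.
  move=> t; split=> //.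
  (* A nonzero normal vector in one of the two factors keeps [g t] out of the interior. *)
  have [at1|bt1] := ab1 t.
    apply: (@normal_cone_not_interior _ _ _ (col_mx (a t *: p) 0)); last first.
      rewrite col_mx_eq0 negb_and scaler_eq0 negb_or p0 andbT.
      by rewrite -normr_eq0 at1 oner_eq0.
    apply/normal_cone_phase_prod => //; rewrite /g !col_mxKu !col_mxKd.
    by split; [apply: normalX; rewrite ?sq1|exact: zero_normal].
  apply: (@normal_cone_not_interior _ _ _ (col_mx 0 (b t *: x))); last first.
    rewrite col_mx_eq0 negb_and scaler_eq0 negb_or x0 andbT.
    by rewrite -[b t == 0]normr_eq0 bt1 oner_eq0 orbT.
  apply/normal_cone_phase_prod => //; rewrite /g !col_mxKu !col_mxKd.
  by split; [exact: zero_normal|apply: normalP; rewrite ?sq1].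
have gE_derive (t : R) (i : 'I_(n + n)) : is_derive t 1 (fun t => g t i 0)
    (col_mx (da t *: x) (db t *: p) i 0).
  have scale_derive (c : R -> R) dc (k : R) : is_derive t 1 c dc ->
      is_derive t 1 (fun t => c t * k) (dc * k).
    move=> ct; rewrite mulrC (_ : (fun t => c t * k) = k \*: c).
      exact: is_deriveZ.
    by apply/funext => r; rewrite /= mulrC.
  case: (split_ordP i) => j ->.
    rewrite col_mxEu mxE (_ : (fun t => g t _ 0) = fun t => a t * x j 0).
      exact/scale_derive/(ab_derive t).1.
    by apply/funext => r; rewrite /g col_mxEu mxE.
  rewrite col_mxEd mxE (_ : (fun t => g t _ 0) = fun t => b t * p j 0).
    exact/scale_derive/(ab_derive t).2.
  by apply/funext => r; rewrite /g col_mxEd mxE.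
split.
  exists (4 * (`|x| + `|p|)) => s t.
  have aC := @derive_le_lipschitz R a da 4 (fun t => (ab_derive t).1) (fun t => (dab_le t).1) s t.
  have bC := @derive_le_lipschitz R b db 4 (fun t => (ab_derive t).2) (fun t => (dab_le t).2) s t.
  have -> : g s - g t = col_mx ((a s - a t) *: x) ((b s - b t) *: p).
    by rewrite /g opp_col_mx add_col_mx !scalerBl.
  have := normr_ge0 x; have := normr_ge0 p; have := normr_ge0 (s - t) => ? ? ?.
  have -> : 4 * (`|x| + `|p|) * `|s - t| = 4 * `|s - t| * `|x| + 4 * `|s - t| * `|p|.
    by ring.
  apply: normr_col_mx_le; rewrite normrZ.
    apply: (@le_trans _ _ (4 * `|s - t| * `|x|)); first exact: ler_wpM2r.
    by rewrite lerDl !mulr_ge0.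
  apply: (@le_trans _ _ (4 * `|s - t| * `|p|)); first exact: ler_wpM2r.
  by rewrite lerDr !mulr_ge0.
split.
  exists 0, (pi / 2); apply/eqP => /(congr1 usubmx)/eqP.
  by rewrite /g !col_mxKu a0 a1 scale0r scale1r eq_sym (negbTE x0).
(* The smoothed clamp makes the orbit differentiable at every time, corners included. *)
exists set0; split; first exact: negligible_set0.
move=> t _.
have dg : derivable g t 1.
  by apply/derivable_mxP => i j; rewrite (ord1 j); case: (gE_derive t i).
(* This is the vector that [J] maps to the velocity [(da t *: x, db t *: p)]. *)
split=> //; exists (col_mx (- (db t *: p)) (da t *: x)).
  apply/normal_cone_phase_prod => //; rewrite /g !col_mxKu !col_mxKd; split.
    have [->|/db_a[at1 ab0]] := eqVneq (db t) 0; first by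
      rewrite scale0r oppr0; exact: zero_normal.
    by rewrite -scaleNr; apply: normalX => //; rewrite mulrN oppr_ge0.
  have [->|/da_b[bt1 ab0]] := eqVneq (da t) 0; first by rewrite scale0r; exact: zero_normal.
  exact: normalP.
rewrite derive_mx// -[RHS]vsubmxK usubmx_Jmx dsubmx_Jmx col_mxKu col_mxKd opprK.
by apply/matrixP => i j; rewrite mxE (ord1 j); case: (gE_derive t i).
Qed.

End bouncing_orbit.

Theorem theorem2 (R : realType) (n : nat) (hbar : R) (Sigma : 'M[R]_(n + n)) :
  0 < hbar -> (1 <= n)%N ->
  Sigma^T = Sigma ->
  herm_psd (cplx_mx Sigma + ('i * ((hbar / 2)%:C)%C) *: cplx_mx (Jmx R n)) ->
  quantum_pair hbar (projX (Omega Sigma)) (projP (Omega Sigma)) /\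
  4 * hbar <= cHZ (phase_prod (projX (Omega Sigma)) (projP (Omega Sigma))).
Proof.
move=> hbar0 n1 Sigma_sym /herm_psd_Jmx uncert.
have S_posdef := herm_psd_posdef hbar0 Sigma_sym uncert.
have bX := projX_sym_convex_body S_posdef.
have bP := projP_sym_convex_body S_posdef.
have XP := hpolar_projX_subset S_posdef hbar0 uncert.
set X := projX _ in bX XP *; set P := projP _ in bP XP *.
split; first by [].
have compact_norm (K : set 'cV[R]_n) : compact K -> exists M, forall y, K y -> `|y| <= M.
  move=> /compact_bounded[M [_ KM]]; exists (M + 1) => y Ky.
  by apply: KM => //; rewrite ltrDl.
have [M1 XM1] := compact_norm _ bX.1.1.
have [M2 PM2] := compact_norm _ bP.1.1.
pose M := Num.max M1 M2.
have XM y : X y -> `|y| <= M by move=> /XM1 yM; rewrite le_max yM.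
have PM y : P y -> `|y| <= M by move=> /PM2 yM; rewrite le_max yM orbT.
(* The infimum of an empty set is 0 by default, so a characteristic of positive action has to be
   produced first. *)
apply: lb_le_inf.
  have [g [T [p [s [gT Pp PNp sT gt0]]]]] := bouncing_closed_characteristic n1 bX bP.
  have [_ A_ge] := closed_characteristic_action hbar0 bX.2 XP XM PM gT.
  exists (action g T), g, T; split=> //; split=> //.
  exact: lt_le_trans (A_ge _ _ _ Pp PNp sT).
move=> _ [g [T [gT [-> A0]]]].
by have [A_ge _] := closed_characteristic_action hbar0 bX.2 XP XM PM gT; exact: A_ge.
Qed.
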